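(* Let $Y$ be a nonempty proper convex subset of $X$. If $Y$ has no minimum and no maximum, then $\operatorname{rank}(\mathcal{OP}(X,Y):\mathcal{O}(X,Y))$ is infinite.
   Context: Maps are written on the right of their arguments and composed from left to right. Throughout, $X$ is an infinite linearly ordered set that is dense (for all $x<y$ in $X$ there is $z\in X$ with $x<z<y$). A subset $C\subseteq X$ is convex if $x,y\in C$, $z\in X$ and $x<z<y$ imply $z\in C$; an open convex subset of $X$ is a nonempty convex subset of $X$ having neither a minimum nor a maximum. For sets, $A<B$ means $a<b$ for all $a\in A$, $b\in B$. It is assumed that $X$ satisfies: (a) if $X=X'\cup X''$ with $X'<X''$ and $X',X''\neq\emptyset$, then $X'$ has a maximum or $X''$ has a minimum; (b) any two open convex subsets of $X$ are order-isomorphic (i.e., there is an order-preserving bijection between them). $\mathcal{T}(X)$ is the monoid of all maps $X\to X$ under composition, and $\mathcal{O}(X)$ is its submonoid of order-preserving maps ($x\le y$ implies $x\alpha\le y\alpha$). A map $\alpha\in\mathcal{T}(X)$ is orientation-preserving if there is a nonempty subset $X_1\subseteq X$ such that, with $X_2=X\setminus X_1$: (1) $\alpha$ is order-preserving on $X_1$ and on $X_2$; and (2) for all $p\in X_1$ and $q\in X_2$, $p<q$ and $p\alpha\ge q\alpha$. $\mathcal{OP}(X)$ is the monoid of all orientation-preserving maps on $X$. For a nonempty $Y\subseteq X$, $\mathcal{O}(X,Y)=\{\alpha\in\mathcal{O}(X):\operatorname{im}\alpha\subseteq Y\}$ and $\mathcal{OP}(X,Y)=\{\alpha\in\mathcal{OP}(X):\operatorname{im}\alpha\subseteq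 Y\}$; these are semigroups with $\mathcal{O}(X,Y)\subseteq\mathcal{OP}(X,Y)$. For a semigroup $S$ and $A\subseteq S$, the relative rank $\operatorname{rank}(S:A)$ is the minimal cardinality of a set $B\subseteq S$ such that $A\cup B$ generates $S$. *)

(* Defs.v *)
From HB Require Import structures.
From mathcomp Require Import all_boot all_order.
From mathcomp Require Import all_classical.

Set Implicit Arguments.
Unset Strict Implicit.
Unset Printing Implicit Defensive.

Import Order.TTheory.

Local Open Scope card_scope.
Local Open Scope order_scope.
Local Open Scope classical_set_scope.

Section Subsets.
Context {d : Order.disp_t} {X : orderType d}.
Implicit Types A B C : set X.

Definition set_lt A B := forall a b, A a -> B b -> a < b.

Definition has_min A := A `&` lbound A !=set0.

Definition has_max A := A `&` ubound A !=set0.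

Definition convex_subset C := forall x y z, C x -> C y -> x < z < y -> C z.

Definition open_convex_subset C :=
  [/\ C !=set0, convex_subset C, ~ has_min C & ~ has_max C].

Definition order_preserving_on A (f : X -> X) :=
  {in A &, {homo f : x y / x <= y}}.

Definition order_isomorphic A B :=
  exists f : X -> X, set_bij A B f /\ order_preserving_on A f.

End Subsets.

Definition densely_ordered {d} (X : orderType d) :=
  forall x y : X, x < y -> exists z : X, x < z < y.

Definition cuts_not_gaps {d} (X : orderType d) :=
  forall A B : set X, A `|` B = [set: X] -> set_lt A B ->
    A !=set0 -> B !=set0 -> has_max A \/ has_min B.

Definition open_convex_isomorphic {d} (X : orderType d) :=
  forall A B : set X, open_convex_subset A -> open_convex_subset B ->
    order_isomorphic A B.

(* Maps act on the right of their arguments: the product a * b is a followed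
   by b. *)
Definition full_transf (X : Type) := X -> X.

Section FullTransformationMonoid.
Variable X : choiceType.

Definition transf_mul (a b : full_transf X) : full_transf X := fun x => b (a x).

Fact transf_mulA : associative transf_mul. Proof. by []. Qed.

Fact transf_mul1g : left_id (idfun : full_transf X) transf_mul.
Proof. by []. Qed.

Fact transf_mulg1 : right_id (idfun : full_transf X) transf_mul.
Proof. by []. Qed.

HB.instance Definition _ := Choice.copy (full_transf X) (X -> X).
HB.instance Definition _ := isMonoid.Build (full_transf X)
  transf_mulA transf_mul1g transf_mulg1.

End FullTransformationMonoid.

Section OrientationPreserving.
Context {d : Order.disp_t} (X : orderType d).

Definition orientation_preserving (a : X -> X) :=
  exists X1 : set X, let X2 := ~` X1 in
    [/\ X1 !=set0,
        order_preserving_on X1 a,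
        order_preserving_on X2 a &
        forall p q, X1 p -> X2 q -> p < q /\ a q <= a p].

Definition order_preserving_maps (Y : set X) : set (full_transf X) :=
  [set a | {homo a : x y / x <= y} /\ range a `<=` Y].

Definition orientation_preserving_maps (Y : set X) : set (full_transf X) :=
  [set a | orientation_preserving a /\ range a `<=` Y].

End OrientationPreserving.

Section RelativeRank.
Context {T : semigroupType}.
Implicit Types S A B : set T.

Definition mul_closed S := forall a b : T, S a -> S b -> S (a * b)%g.

Definition subsemigroup_generated_by A : set T := smallest mul_closed A.

Definition generates_modulo S A B :=
  B `<=` S /\ subsemigroup_generated_by (A `|` B) = S.

(* rank(S : A) as a cardinal, represented by a set of that cardinality: a
   chosen B of least cardinality with <A, B> = S.  By relative_rankP below such
   a B exists whenever S is a subsemigroup containing A; the default set0 of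
   xget plays no role then. *)
Definition relative_rank S A : set T :=
  xget set0 [set B | generates_modulo S A B /\
                     forall C, generates_modulo S A C -> B #<= C].

End RelativeRank.

Section RelativeRankExists.

Lemma min_card_ex (T : Type) (F : set (set T)) : F !=set0 ->
  exists2 B, F B & forall C, F C -> B #<= C.
Proof.
move=> [B0 FB0].
pose P (E : set (set T -> T)) := (forall f C, E f -> F C -> C (f C)) /\
  (forall f g C, E f -> E g -> F C -> f C = g C -> f = g).
have [|E [[EC Einj] Emax]] := @Zorn_bigcup _ P.
  move=> G GP Gtot; split=> [f C [E GE Ef] | f g C [E GE Ef] [E' GE' E'g]].
    exact: (GP _ GE).1.
  by case: (Gtot _ _ GE GE') => [/(_ _ Ef)|/(_ _ E'g)] ?;
    [apply: (GP _ GE').2 | apply: (GP _ GE).2].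
have [[B FB BE]|noB] :=
    pselect (exists2 B, F B & forall x, B x -> exists2 f, E f & f B = x).
  exists B => // C FC.
  have /choice[h hP] : forall x, exists f, B x -> E f /\ f B = x.
    move=> x; have [/BE[f Ef fx]|nBx] := pselect (B x); first by exists f.
    by exists (fun=> x).
  suff [f] : $|{injfun B >-> C}| by exact: inj_card_le f.
  apply/injfunPex; exists (fun x => h x C).
    by move=> x /hP[Eh _]; exact: (EC _ _ Eh FC).
  move=> x y; rewrite !inE => /hP[Ex xE] /hP[Ey yE] /(Einj _ _ _ Ex Ey FC) hxy.
  by rewrite -xE -yE hxy.
have out C : F C -> exists x, C x /\ forall f, E f -> f C <> x.
  move=> FC; apply: contrapT => no; apply: noB; exists C => // x Cx.
  apply: contrapT => nof; apply: no; exists x; split=> // f Ef fx.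
  by apply: nof; exists f.
have [t0 _] := out _ FB0.
have /choice[g gP] : forall C, exists x, F C -> C x /\ forall f, E f -> f C <> x.
  move=> C; have [/out[x xP]|nFC] := pselect (F C); first by exists x.
  by exists t0.
exfalso; apply: (Emax (E `|` [set g])).
  split; first by move=> f Ef; left.
  move=> /(_ g (or_intror erefl)) Eg.
  by have [_ /(_ g Eg)] := gP _ FB0.
split=> [f C [Ef|->] FC|f f' C [Ef|->] [Ef'|->] FC e //].
- exact: (EC _ _ Ef FC).
- exact: (gP _ FC).1.
- exact: (Einj _ _ _ Ef Ef' FC e).
- by have [_ /(_ f Ef)] := gP _ FC.
- by have [_ /(_ f' Ef')] := gP _ FC; rewrite e.
Qed.

Lemma relative_rankP (T : semigroupType) (S A : set T) :
  mul_closed S -> A `<=` S ->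
  generates_modulo S A (relative_rank S A) /\
  forall C, generates_modulo S A C -> relative_rank S A #<= C.
Proof.
move=> Smul AS; pose P := [set B | generates_modulo S A B /\
  forall C, generates_modulo S A C -> B #<= C].
suff exP : exists B, P B by exact: (xgetPex set0 exP).
have [|B genB Bmin] := @min_card_ex _ (generates_modulo S A).
  exists S; split; first by [].
  have -> : A `|` S = S.
    by apply/seteqP; split=> [x [/AS|]|x Sx] //; right.
  exact: smallest_id.
by exists B.
Qed.

End RelativeRankExists.

(* Main.v *)
Require Import Defs.
From HB Require Import structures.
From mathcomp Require Import all_boot all_order.
From mathcomp Require Import all_classical.

Set Implicit Arguments.
Unset Strict Implicit.
Unset Printing Implicit Defensive.

Import Order.TTheory.

Local Open Scope order_scope.
Local Open Scope classical_set_scope.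

(** Being convex and proper, [Y] lies strictly on one side of some point [s];
by duality of the order, say [Y < s].  Two facts about maps into [Y] then
decide the matter.

- An order-preserving map sends [Y] weakly below the image of [s], a point of
  [Y]; since [Y] has no maximum, a product of at least two maps, the last of
  which is order-preserving, does not have its image cofinal in [Y].
- If an orientation-preserving map that is not order-preserving has its image
  cofinal in [Y], then its image is bounded below in [Y]
  ([cofinal_image_bounded_below]).  Indeed, let [X1 < X2] be its two pieces.  A
  maximum of [X1] would be sent to an upper bound of the image, so [X2] has a
  minimum because cuts are not gaps, and this minimum is sent to a lower bound
  of the image.

Let [B], together with the order-preserving maps, generate all
orientation-preserving maps into [Y].  If [B] were finite, then, as [Y] has no
minimum, some [y0] in [Y] would lie strictly below the image of each element of
[B] that is cofinal and not order-preserving.  The image of a product is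
contained in that of its last factor, so the image of every generated map that
is cofinal and not order-preserving would also lie strictly above [y0].  But
the map that sends [x] to the maximum of [x] and [y0] on [Y], and to [y0]
elsewhere, is orientation-preserving and cofinal, is not order-preserving, and
takes the value [y0].

The relative rank is the cardinality of an actual generating set only because
the orientation-preserving maps are closed under composition
([mul_closed_orientation_preserving_maps]). *)

(** * Composition of orientation-preserving maps *)

Section OrientationPreservingMaps.
Context {d : Order.disp_t} {X : orderType d}.
Implicit Types (Y : set X) (a b : full_transf X).

Lemma homo_orientation_preserving (a : X -> X) (x0 : X) :
  {homo a : x y / x <= y} -> orientation_preserving a.
Proof.
move=> ha; exists [set: X]; split.
- by exists x0.
- by move=> x y _ _; exact: ha.
- by move=> x y /set_mem nx; exfalso; apply: nx.
- by move=> p q _ nq; exfalso; apply: nq.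
Qed.

(** Let [X1], [X2] be the pieces of [a], and [Y1], [Y2] those of [b].  If [a]
sends some point of [X1] into [Y1], then it sends all of [X2] into [Y1], and the
first piece of [a * b] is the part of [X1] sent into [Y1].  Otherwise [a] sends
[X1] into [Y2], and the first piece of [a * b] is [X1] together with the part of
[X2] sent into [Y1]. *)
Lemma orientation_preserving_mul a b :
  orientation_preserving a -> orientation_preserving b ->
  orientation_preserving (a * b)%g.
Proof.
move=> [X1 [[x1 X1x1] a1 a2 a12]] [Y1 [_ b1 b2 b12]].
have ha1 x y : X1 x -> X1 y -> x <= y -> a x <= a y.
  by move=> X1x X1y; apply: a1; apply/mem_set.
have ha2 x y : ~ X1 x -> ~ X1 y -> x <= y -> a x <= a y.
  by move=> X1x X1y; apply: a2; apply/mem_set.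
have ha x y : X1 x -> ~ X1 y -> a y <= a x by move=> /a12/[apply]-[].
have lta x y : X1 x -> ~ X1 y -> x < y by move=> /a12/[apply]-[].
have hb1 x y : Y1 x -> Y1 y -> x <= y -> b x <= b y.
  by move=> Y1x Y1y; apply: b1; apply/mem_set.
have hb2 x y : ~ Y1 x -> ~ Y1 y -> x <= y -> b x <= b y.
  by move=> Y1x Y1y; apply: b2; apply/mem_set.
have hb x y : Y1 x -> ~ Y1 y -> b y <= b x by move=> /b12/[apply]-[].
have Y1down x y : x <= y -> Y1 y -> Y1 x.
  move=> xy Y1y; apply: contrapT => nY1x.
  by have [+ _] := b12 _ _ Y1y nY1x; rewrite ltNge xy.
have [[p0 [X1p0 Y1p0]]|noX1Y1] := pselect (exists p, X1 p /\ Y1 (a p)).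
  have X2Y1 q : ~ X1 q -> Y1 (a q) by move=> /(ha _ _ X1p0)/Y1down; exact.
  exists [set x | X1 x /\ Y1 (a x)]; split.
  - by exists p0.
  - move=> x y /set_mem[X1x Y1x] /set_mem[X1y Y1y] xy.
    by apply: hb1 => //; exact: ha1.
  - move=> x y /set_mem/not_andP nx /set_mem/not_andP ny xy.
    have [X1x|X2x] := pselect (X1 x); have [X1y|X2y] := pselect (X1 y).
    + case: nx => // Y2x; case: ny => // Y2y.
      by apply: hb2 => //; exact: ha1.
    + by case: nx => // Y2x; apply: hb => //; exact: X2Y1.
    + by have := lta _ _ X1y X2x; rewrite ltNge xy.
    + by apply: hb1; [exact: X2Y1 | exact: X2Y1 | exact: ha2].
  - move=> p q [X1p Y1p] /not_andP nq.
    have [X1q|X2q] := pselect (X1 q); last first.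
      split; first exact: lta.
      by apply: hb1; [exact: X2Y1 | | exact: ha].
    case: nq => // Y2q; split; last exact: hb.
    rewrite ltNge; apply/negP => /(ha1 _ _ X1q X1p) qp.
    by apply: Y2q; exact: Y1down Y1p.
have X1Y2 p : X1 p -> ~ Y1 (a p) by move=> X1p Y1p; apply: noX1Y1; exists p.
exists [set x | X1 x \/ Y1 (a x)]; split.
- by exists x1; left.
- move=> x y /set_mem Zx /set_mem Zy xy.
  have [X1x|X2x] := pselect (X1 x); have [X1y|X2y] := pselect (X1 y).
  + by apply: hb2; [exact: X1Y2 | exact: X1Y2 | exact: ha1].
  + by case: Zy => // Y1y; apply: hb => //; exact: X1Y2.
  + by have := lta _ _ X1y X2x; rewrite ltNge xy.
  + case: Zx => // Y1x; case: Zy => // Y1y.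
    by apply: hb1 => //; exact: ha2.
- move=> x y /set_mem/not_orP[X2x Y2x] /set_mem/not_orP[X2y Y2y] xy.
  by apply: hb2 => //; exact: ha2.
- move=> p q Zp /not_orP[X2q Y2q].
  have [X1p|X2p] := pselect (X1 p).
    split; first exact: lta.
    by apply: hb2; [ | exact: X1Y2 | exact: ha].
  case: Zp => // Y1p; split; last exact: hb.
  rewrite ltNge; apply/negP => /(ha2 _ _ X2q X2p) qp.
  by apply: Y2q; exact: Y1down Y1p.
Qed.

Lemma mul_closed_orientation_preserving_maps Y :
  mul_closed (orientation_preserving_maps Y).
Proof.
move=> a b [opa _] [opb bY]; split; first exact: orientation_preserving_mul.
by move=> _ [x _ <-]; apply: bY; exists (a x).
Qed.

Lemma sub_order_preserving_maps Y : Y !=set0 ->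
  order_preserving_maps Y `<=` orientation_preserving_maps Y.
Proof.
move=> [y0 _] a [ha aY]; split=> //.
exact: (homo_orientation_preserving y0 ha).
Qed.

End OrientationPreservingMaps.

(** * Generating sets when [Y] is bounded above *)

Section BoundedAbove.
Context {d : Order.disp_t} {X : orderType d}.
Variable Y : set X.
Hypotheses (Y_nonempty : Y !=set0) (Y_no_min : ~ has_min Y)
  (Y_no_max : ~ has_max Y).

Lemma no_min_lt y : Y y -> exists2 z, Y z & z < y.
Proof.
move=> Yy; apply: contrapT => noz; apply: Y_no_min; exists y; split=> // z Yz.
by rewrite leNgt; apply/negP => zy; apply: noz; exists z.
Qed.

Lemma no_max_gt y : Y y -> exists2 z, Y z & y < z.
Proof.
move=> Yy; apply: contrapT => noz; apply: Y_no_max; exists y; split=> // z Yz.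
by rewrite leNgt; apply/negP => zy; apply: noz; exists z.
Qed.

(** The image of [g], assumed to be contained in [Y], is cofinal in [Y]. *)
Definition cofinal_image (g : X -> X) :=
  forall y, Y y -> exists x, y <= g x.

Lemma not_cofinal_image (g : X -> X) m :
  Y m -> (forall x, g x <= m) -> ~ cofinal_image g.
Proof.
move=> Ym gm cg; have [z Yz mz] := no_max_gt Ym.
by have [x /(lt_le_trans mz)] := cg z Yz; rewrite ltNge gm.
Qed.

Lemma cofinal_image_bounded_below (g : X -> X) : cuts_not_gaps X ->
  orientation_preserving_maps Y g -> ~ {homo g : x y / x <= y} ->
  cofinal_image g -> exists2 m, Y m & forall x, m <= g x.
Proof.
move=> X_cuts [[X1 [X1ne g1 g2 g12]] gY] ngo cg.
have [X2ne|X2e] := pselect (~` X1 !=set0); last first.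
  have X1T x : x \in X1.
    by apply/mem_set; apply: contrapT => X2x; apply: X2e; exists x.
  by exfalso; apply: ngo => x y; exact: g1.
have lt12 : set_lt X1 (~` X1) by move=> p q /g12/[apply]-[].
have [[p [X1p pmax]]|[q [X2q qmin]]] :=
    X_cuts _ _ (setUv X1) lt12 X1ne X2ne.
  exfalso; apply: (@not_cofinal_image g (g p)) => //; first by apply: gY; exists p.
  move=> x; have [X1x|X2x] := pselect (X1 x).
    by apply: g1; [exact/mem_set | exact/mem_set | exact: pmax].
  by have [] := g12 _ _ X1p X2x.
exists (g q); first by apply: gY; exists q.
move=> x; have [X1x|X2x] := pselect (X1 x).
  by have [] := g12 _ _ X1x X2q.
by apply: g2; [exact/mem_set | exact/mem_set | exact: qmin].
Qed.

(** Finitely many maps with images bounded below in [Y] have a common strict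
lower bound in [Y]: [Y] has no minimum, and it is nonempty, which matters when
there are no maps. *)
Lemma finite_strict_lower_bound (C : set (full_transf X)) : finite_set C ->
  (forall b, C b -> exists2 m, Y m & forall x, m <= b x) ->
  exists2 y0, Y y0 & forall b, C b -> forall x, y0 < b x.
Proof.
move=> /finite_seqP[s ->]; elim: s => [|c s IHs] Cbd.
  by have [y0 Yy0] := Y_nonempty; exists y0.
have [|y1 Yy1 y1P] := IHs.
  by move=> b bs; apply: Cbd; rewrite /= inE bs orbT.
have [|m Ym mP] := Cbd c; first by rewrite /= inE eqxx.
have [z Yz zm] := no_min_lt Ym.
exists (Order.min y1 z); first by rewrite /Order.min; case: ifP.
move=> b /=; rewrite inE => /orP[/eqP->|bs] x; rewrite gt_min.
  by rewrite (lt_le_trans zm (mP x)) orbT.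
by rewrite y1P.
Qed.

(** A map with image cofinal in [Y] that has [y0] as its least value: the
identity on the part of [Y] above [y0], and constant elsewhere. *)
Definition clip (y0 : X) : full_transf X :=
  fun x => if x \in Y then Order.max x y0 else y0.

Lemma clip_in y0 x : Y y0 -> Y (clip y0 x).
Proof.
move=> Yy0; rewrite /clip; case: ifPn => // /set_mem Yx.
by rewrite /Order.max; case: ifP.
Qed.

Lemma clip_ge y0 x : y0 <= clip y0 x.
Proof. by rewrite /clip; case: ifP; rewrite // le_max lexx orbT. Qed.

Lemma clip_cofinal_image y0 : cofinal_image (clip y0).
Proof.
by move=> y Yy; exists y; rewrite /clip (mem_set Yy) le_max lexx.
Qed.

Lemma clip_orientation_preserving y0 : convex_subset Y -> Y y0 ->
  orientation_preserving_maps Y (clip y0).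
Proof.
move=> Y_convex Yy0; split; last by move=> _ [x _ <-]; exact: clip_in.
exists [set x | exists2 y, Y y & x <= y].
have out q : ~ (exists2 y, Y y & q <= y) -> clip y0 q = y0.
  move=> nq; rewrite /clip; case: ifPn => // /set_mem Yq.
  by exfalso; apply: nq; exists q.
split.
- by exists y0; exists y0.
- move=> x x' _ /set_mem[y Yy x'y] xx'.
  rewrite [leLHS]/clip; case: ifPn => [/set_mem Yx|_]; last exact: clip_ge.
  have Yx' : Y x'.
    move: x'y xx'; rewrite !le_eqVlt => /orP[/eqP->//|x'y] /orP[/eqP<-//|xx'].
    by apply: (Y_convex x y) => //; rewrite xx'.
  by rewrite /clip (mem_set Yx') ge_max !le_max xx' lexx orbT.
- by move=> x x' /set_mem nx /set_mem nx' _; rewrite !out.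
- move=> p q [y Yy py] nq; split; last by rewrite out // clip_ge.
  rewrite ltNge; apply/negP => qp; apply: nq; exists y => //.
  exact: le_trans py.
Qed.

Lemma clip_not_homo y0 s : Y y0 -> (forall y, Y y -> y < s) ->
  ~ {homo clip y0 : x y / x <= y}.
Proof.
move=> Yy0 Ys ho; have [y1 Yy1 y01] := no_max_gt Yy0.
have := ho _ _ (ltW (Ys _ Yy1)).
rewrite /clip (mem_set Yy1) ifN; last first.
  by apply/negP => /set_mem/Ys; rewrite ltxx.
by rewrite ge_max leNgt y01.
Qed.

Lemma generators_infinite_of_bounded_above s (B : set (full_transf X)) :
  cuts_not_gaps X -> convex_subset Y -> (forall y, Y y -> y < s) ->
  generates_modulo (orientation_preserving_maps Y) (order_preserving_maps Y) B ->
  infinite_set B.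
Proof.
move=> X_cuts Y_convex Ys [BS genB] finB.
pose bad (g : full_transf X) :=
  cofinal_image g /\ ~ {homo g : x y / x <= y}.
have [||y0 Yy0 y0P] := @finite_strict_lower_bound (B `&` bad).
- exact: finite_setIl.
- by move=> b [/BS OPb [cb nb]]; exact: cofinal_image_bounded_below.
(* [G] contains every generator and is closed under products, but does not
   contain [clip y0]. *)
pose G : set (full_transf X) :=
  [set g | range g `<=` Y /\ (bad g -> forall x, y0 < g x)].
have OPG : orientation_preserving_maps Y `<=` G.
  rewrite -genB; apply: smallest_sub.
    move=> a b [aY _] [bY bP]; split.
      by move=> _ [x _ <-]; apply: bY; exists (a x).
    move=> [cab _] x; apply: bP; split.
      by move=> y /cab[x' yx']; exists (a x').
    move=> hb; apply: (not_cofinal_image _ _ cab); first by apply: bY; exists s.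
    by move=> x'; apply: hb; apply/ltW/Ys/aY; exists x'.
  move=> g [[hg gY]|Bg]; first by split=> // -[_ /(_ hg)].
  have [_ gY] := BS _ Bg; split=> // badg; exact: y0P.
have [_] := OPG _ (clip_orientation_preserving Y_convex Yy0).
have bad_clip : bad (clip y0).
  by split; [exact: clip_cofinal_image | exact: clip_not_homo Ys].
by move=> /(_ bad_clip y0); rewrite /clip (mem_set Yy0) maxxx ltxx.
Qed.

End BoundedAbove.

(** * Reversing the order *)

Section Dual.
Context {d : Order.disp_t} {X : orderType d}.
Implicit Type Y : set X.

Lemma cuts_not_gaps_dual : cuts_not_gaps X -> cuts_not_gaps X^d.
Proof.
move=> X_cuts A B AB ltAB A0 B0.
have ltBA : @set_lt _ X B A by move=> b a Bb Aa; exact: ltAB.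
rewrite setUC in AB.
by case: (X_cuts B A AB ltBA B0 A0) => ?; [right | left].
Qed.

Lemma convex_subset_dual Y : convex_subset Y -> @convex_subset _ X^d Y.
Proof.
by move=> cY x y z Yx Yy /andP[xz zy]; apply: (cY y x z) => //; apply/andP.
Qed.

(** Reversing the order exchanges the two pieces of an orientation-preserving
map, unless the second one is empty and the map is order-preserving. *)
Lemma orientation_preserving_dual (a : X -> X) :
  orientation_preserving a -> @orientation_preserving _ X^d a.
Proof.
move=> [X1 [[x1 X1x1] a1 a2 a12]].
have [[x2 X2x2]|X2e] := pselect (~` X1 !=set0); last first.
  have X1T x : x \in X1.
    by apply/mem_set; apply: contrapT => X2x; apply: X2e; exists x.
  apply: (@homo_orientation_preserving _ X^d a x1) => x y xy.
  exact: (a1 y x).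
exists (~` X1); rewrite setCK; split.
- by exists x2.
- by move=> x y X2x X2y xy; exact: (a2 y x).
- by move=> x y X1x X1y xy; exact: (a1 y x).
- by move=> p q X2p X1q; exact: (a12 q p).
Qed.

Lemma order_preserving_maps_dual Y :
  @order_preserving_maps _ X^d Y = order_preserving_maps Y.
Proof.
by apply/seteqP; split=> a [ha aY]; split=> // x y; exact: (ha y x).
Qed.

End Dual.

Lemma orientation_preserving_maps_dual d (X : orderType d) (Y : set X) :
  @orientation_preserving_maps _ X^d Y = orientation_preserving_maps Y.
Proof.
apply/seteqP; split=> a [opa aY]; split=> //.
  exact: (@orientation_preserving_dual _ X^d a opa).
exact: orientation_preserving_dual.
Qed.

Lemma generators_infinite_of_bounded_below d (X : orderType d) (Y : set X) s
    (B : set (full_transf X)) :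
  Y !=set0 -> ~ has_min Y -> ~ has_max Y ->
  cuts_not_gaps X -> convex_subset Y -> (forall y, Y y -> s < y) ->
  generates_modulo (orientation_preserving_maps Y) (order_preserving_maps Y) B ->
  infinite_set B.
Proof.
move=> Y0 Ymin Ymax X_cuts Y_convex Ys.
rewrite -order_preserving_maps_dual -orientation_preserving_maps_dual.
apply: (@generators_infinite_of_bounded_above _ X^d Y Y0 Ymax Ymin s).
- exact: cuts_not_gaps_dual.
- exact: convex_subset_dual.
- exact: Ys.
Qed.

(** * Infiniteness of the relative rank *)

Lemma proper_convex_strict_bound d (X : orderType d) (Y : set X) :
  convex_subset Y -> Y <> [set: X] ->
  exists s, (forall y, Y y -> y < s) \/ (forall y, Y y -> s < y).
Proof.
move=> Y_convex Y_proper.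
have [s nYs] : exists s, ~ Y s.
  apply: contrapT => noS; apply: Y_proper; apply/seteqP; split=> // x _.
  by apply: contrapT => nYx; apply: noS; exists x.
have neq y : Y y -> y != s by move=> Yy; apply/eqP => ys; apply: nYs; rewrite -ys.
exists s; have [[y1 [Yy1 y1s]]|no] := pselect (exists y, Y y /\ y < s).
  left=> y Yy; have := neq _ Yy; case: ltgtP => // sy _.
  by exfalso; apply: nYs; apply: (Y_convex y1 y) => //; rewrite y1s.
right=> y Yy; have := neq _ Yy; case: ltgtP => // ys _.
by exfalso; apply: no; exists y.
Qed.

Theorem proposition9 (d : Order.disp_t) (X : orderType d)
  (X_infinite : infinite_set [set: X])
  (X_dense : densely_ordered X)
  (X_cuts : cuts_not_gaps X)
  (X_iso : open_convex_isomorphic X)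
  (Y : set X)
  (Y_nonempty : Y !=set0)
  (Y_proper : Y <> [set: X])
  (Y_convex : convex_subset Y)
  (Y_no_min : ~ has_min Y)
  (Y_no_max : ~ has_max Y) :
  infinite_set
    (relative_rank (orientation_preserving_maps Y) (order_preserving_maps Y)).
Proof.
have [gen _] := relative_rankP (@mul_closed_orientation_preserving_maps _ _ Y)
  (sub_order_preserving_maps Y_nonempty).
have [s [Ys|Ys]] := proper_convex_strict_bound Y_convex Y_proper.
  exact: (generators_infinite_of_bounded_above _ _ _ _ _ Ys gen).
exact: (generators_infinite_of_bounded_below _ _ _ _ _ Ys gen).
Qed.
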